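(* Let $G$ be a CCA group. Then $G$ is strongly CCA if either: (1) $G$ is abelian, or (2) $G$ has odd order.
   Context: All groups are finite. Let $S$ be a subset of a group $G$ with $S = S^{-1}$. The Cayley graph $\mathrm{Cay}(G;S)$ has vertex set $G$ and an edge joining $x$ and $xs$ for each $x \in G$, $s \in S$; the edge between $x$ and $xs$ is coloured with the set $\{s,s^{-1}\}$. It is connected if and only if $S$ generates $G$. A permutation $\varphi$ of $G$ is a colour-preserving automorphism of $\mathrm{Cay}(G;S)$ if $\varphi(xs) \in \{\varphi(x)s,\ \varphi(x)s^{-1}\}$ for all $x \in G$, $s \in S$. A permutation $\varphi$ of $G$ is a colour-permuting automorphism of $\mathrm{Cay}(G;S)$ if there is a permutation $\pi$ of $S$ with $\pi(s^{-1}) = \pi(s)^{-1}$ such that $\varphi(xs) \in \{\varphi(x)\pi(s),\ \varphi(x)\pi(s)^{-1}\}$ for all $x \in G$, $s \in S$. A function $\varphi\colon G \to G$ is affine if there are $\alpha \in \mathrm{Aut}(G)$ and $g \in G$ with $\varphi(x) = \alpha(gx)$ for all $x \in G$. The Cayley graph $\mathrm{Cay}(G;S)$ is CCA (respectively, strongly CCA) if all of its colour-preserving (respectively, colour-permuting) automorphisms are affine functions on $G$. The group $G$ is CCA (respectively, strongly CCA) if every connected Cayley graph on $G$ is CCA (respectively, strongly CCA). *)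

(* Defs.v *)
From HB Require Import structures.
From mathcomp Require Import all_boot all_fingroup.

Set Implicit Arguments.
Unset Strict Implicit.
Unset Printing Implicit Defensive.

Local Open Scope group_scope.

Section CayleyGraphs.

(* The ambient group is the whole finGroupType gT. *)
Variable gT : finGroupType.
Implicit Types (S : {set gT}) (phi pi : {perm gT}).

(* [S^-1] is the pointwise inverse of the set [S]; [1 \in S] is allowed. *)
Definition symmetric_set S : Prop := S^-1 = S.

Definition cayley S : rel gT := [rel x y | [exists s in S, y == x * s]].

Definition cayley_connected S : Prop := forall x y : gT, connect (cayley S) x y.

Definition colour_preserving S phi : Prop :=
  forall x s : gT, s \in S -> phi (x * s) \in [set phi x * s; phi x * s^-1].

(* A permutation of S is encoded as a permutation of gT that fixes every
   element outside S ([perm_on S pi]). *)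
Definition colour_permuting S phi : Prop :=
  exists pi : {perm gT},
    [/\ perm_on S pi,
        forall s : gT, s \in S -> pi s^-1 = (pi s)^-1
      & forall x s : gT, s \in S ->
          phi (x * s) \in [set phi x * pi s; phi x * (pi s)^-1]].

Definition affine (f : gT -> gT) : Prop :=
  exists2 alpha : {perm gT}, alpha \in Aut [set: gT]
    & exists g : gT, forall x : gT, f x = alpha (g * x).

Definition cayley_CCA S : Prop :=
  forall phi, colour_preserving S phi -> affine phi.

Definition cayley_strongly_CCA S : Prop :=
  forall phi, colour_permuting S phi -> affine phi.

Lemma cayley_connectedP S : cayley_connected S <-> <<S>> = [set: gT].
Proof.
split=> [conS | genT x y].
  apply/eqP; rewrite eqEsubset subsetT; apply/subsetP=> y _.
  have /connectP[p pathp ->] := conS 1 y.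
  move: pathp.
  have: (1 : gT) \in <<S>> by exact: group1.
  elim: p (1 : gT) => [|z p IHp] x Sx /=; first by [].
  case/andP=> /exists_inP[s Ss /eqP->].
  by apply: IHp; rewrite groupM ?(mem_gen Ss).
have: x^-1 * y \in <<S>> by rewrite genT inE.
case/gen_prodgP=> n [c Sc def_y].
have{def_y} ->: y = x * \prod_(i < n) c i by rewrite -def_y mulKVg.
elim: n c Sc => [|n IHn] c Sc; first by rewrite big_ord0 mulg1.
rewrite big_ord_recr /= mulgA.
apply: connect_trans (IHn _ (fun i => Sc _)) (connect1 _).
by apply/exists_inP; exists (c ord_max).
Qed.

End CayleyGraphs.

Definition group_CCA (gT : finGroupType) : Prop :=
  forall S : {set gT},
    symmetric_set S -> cayley_connected S -> cayley_CCA S.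

Definition group_strongly_CCA (gT : finGroupType) : Prop :=
  forall S : {set gT},
    symmetric_set S -> cayley_connected S -> cayley_strongly_CCA S.

(* Main.v *)
Require Import Defs.
From mathcomp Require Import all_boot all_fingroup.
From mathcomp Require Import cyclic.

Set Implicit Arguments.
Unset Strict Implicit.
Unset Printing Implicit Defensive.

Local Open Scope group_scope.

(** Write [L_g] for left translation by [g], and let [phi] be a
colour-permuting automorphism of a connected Cayley graph on [S].  Conjugating
by [phi] carries [L_g] to a colour-preserving map [psi_g] (lemma
[conj_translation_preserving]), and [phi] is affine as soon as every [psi_g]
is again a left translation (lemma [affine_translations]).  The CCA property
says that [psi_g] is affine, so [psi_g y = d * a y] for some automorphism [a];
since [psi_g] preserves colours, [a] sends each generator [s] to [s] or [s^-1],
so that [a] is an involution.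

Odd order.  The square of [psi_g] is a translation because [a] is an
involution, and in a group of odd order every element is a square.

Abelian groups.  Let [P] be the group of those [h] such that [L_h] is some
[psi_g]; the claim is that [P] contains every [t] in [S].  Suppose that [t]
is not in [P].  Let [s] be a generator whose colour [phi] sends to that of
[t], oriented so that [psi_s 1 = t].  Commutativity turns [psi_s] into a map
that moves along [t]-edges, so [psi_s y] is [y * t] or [y * t^-1] for every
[y].  This forces [t] to have
order 4, and [psi_s y = t * a y], where [a] fixes [t] and multiplies
each element by [1] or [t ^+ 2] (lemma [nontranslation_structure]).  As [a] is
nontrivial, it inverts some [s'] in [S] without fixing it, and
[u = s' * t^-1] is then an involution moved by [a]; as [a] fixes all squares,
[u] is not a square.

The CCA property is now used for another connection set.  If [r] has order 4
and neither [r] nor [r * u] is a square, then twisting by [r ^+ 2] on a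
suitable subgroup is a colour-preserving map of some connected Cayley graph
that is not affine (lemma [CCA_order4_squares]).  Hence each [r] in [S] lies
in [P], or has order 4 and is a square up to a factor [u].  In the last case
[r ^+ 4 = 1], so all fourth powers of the group lie in [P]; and [r ^+ 2] is a
fourth power, so all squares lie in [P].  But [t], being fixed by [a] while
[u] is not, is itself a square, a contradiction. *)

(** * Conjugates of translations *)

Section ColourPermuting.

Variable gT : finGroupType.
Implicit Types (S : {set gT}) (phi psi : {perm gT}) (g h s t u x y : gT).

Definition conj_translation phi g : {perm gT} := perm (@mulgI gT g) ^ phi.

Lemma conj_translationE phi g y :
  conj_translation phi g y = phi (g * (phi^-1) y).
Proof. by rewrite /conj_translation /conjg !permM permE. Qed.

Lemma translation_group_set phi :
  group_set [set h | [exists g, [forall x, phi (g * x) == h * phi x]]].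
Proof.
apply/group_setP; split.
  by rewrite inE; apply/existsP; exists 1; apply/forallP=> x; rewrite !mul1g.
move=> h h'; rewrite !inE => /existsP[g /forallP gE] /existsP[g' /forallP g'E].
apply/existsP; exists (g * g'); apply/forallP=> x.
by rewrite -!mulgA (eqP (gE _)) (eqP (g'E _)).
Qed.

(** The group of left translations meets its conjugate by [phi] in these
translations. *)
Definition translations phi := Group (translation_group_set phi).

Lemma translationsP phi h :
  reflect (exists g, forall x, phi (g * x) = h * phi x)
    (h \in translations phi).
Proof.
rewrite inE; apply: (iffP existsP) => [[g /forallP gE]|[g gE]]; exists g.
  by move=> x; apply/eqP.
by apply/forallP=> x; apply/eqP.
Qed.

(** Putting [x = 1] identifies [h] as [phi g * (phi 1)^-1], so that
[x |-> (phi 1)^-1 * phi x] is multiplicative. *)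
Lemma affine_translations phi :
  (forall g, exists h, forall x, phi (g * x) = h * phi x) -> affine phi.
Proof.
move=> tr.
have phiM g x : phi (g * x) = phi g * ((phi 1)^-1 * phi x).
  have [h hE] := tr g; rewrite hE mulgA; congr (_ * _).
  by have := hE 1; rewrite mulg1 => ->; rewrite mulgK.
have inj_a : injective (fun x => (phi 1)^-1 * phi x).
  by move=> x y /mulgI/perm_inj.
exists (perm inj_a).
  rewrite inE; apply/andP; split; first by apply/subsetP=> x; rewrite inE.
  by apply/morphicP=> x y _ _; rewrite !permE phiM !mulgA.
exists ((phi^-1) (phi 1 * phi 1)) => x.
by rewrite permE phiM permKV !mulgA mulVg mul1g mulgV mul1g.
Qed.

Lemma gen_subset S (H : {group gT}) :
  cayley_connected S -> S \subset H -> forall x, x \in H.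
Proof.
move=> /cayley_connectedP genS SH x.
have: <<S>> \subset H by rewrite gen_subG.
by rewrite genS => /subsetP->.
Qed.

Lemma fixed_group_set (a : gT -> gT) : {morph a : x y / x * y} ->
  group_set [set x | a x == x].
Proof.
move=> aM; apply/group_setP; split.
  by rewrite inE; apply/eqP/(mulgI (a 1)); rewrite -aM !mulg1.
by move=> x y; rewrite !inE aM => /eqP-> /eqP->.
Qed.

Lemma morph_eq_id S (a : gT -> gT) : cayley_connected S ->
  {morph a : x y / x * y} -> {in S, forall s, a s = s} -> forall x, a x = x.
Proof.
move=> conS aM aS x; apply/eqP.
have := gen_subset (H := Group (fixed_group_set aM)) conS _ x.
by rewrite inE; apply; apply/subsetP=> s /aS e; rewrite inE e.
Qed.

(** A colour-permuting map can be lifted edge by edge: the [t]-edge at [phi x]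
comes from an edge at [x] in a colour that [phi] sends to that of [t].  The last
conclusion holds because the permutation of colours commutes with inversion. *)
Lemma colour_permuting_lift S phi : symmetric_set S -> colour_permuting S phi ->
  forall t x, t \in S -> exists s, [/\ phi (x * s) = phi x * t,
    forall y, phi (y * s) \in [set phi y * t; phi y * t^-1]
    & s^-1 = s -> t^-1 = t].
Proof.
move=> symS [pi [pi_on piV piS]] t x tS.
pose s := (pi^-1) t; have pis : pi s = t by rewrite permKV.
have sS : s \in S by rewrite -(perm_closed _ pi_on) pis.
have sVS : s^-1 \in S by rewrite -symS inE invgK.
have cs y : phi (y * s) \in [set phi y * t; phi y * t^-1].
  by have := piS y s sS; rewrite pis.
have csV y : phi (y * s^-1) \in [set phi y * t; phi y * t^-1].
  by have := piS y _ sVS; rewrite piV // pis invgK setUC.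
have invo : s^-1 = s -> t^-1 = t by move=> e; rewrite -pis -piV // e.
(* If [s] is traversed backwards at [x], use [s^-1]; should that fail as well,
   then [s] is an involution by injectivity of [phi]. *)
have /set2P[e|e] := cs x; first by exists s.
have /set2P[e'|e'] := csV x.
  by exists s^-1; split=> //; rewrite invgK => /esym.
have sV : s^-1 = s by apply: (mulgI x); apply: (@perm_inj _ phi); rewrite e e'.
by exists s; split=> //; rewrite e invo.
Qed.

Lemma conj_translation_preserving S phi g : symmetric_set S ->
  colour_permuting S phi -> colour_preserving S (conj_translation phi g).
Proof.
move=> symS cphi y t tS; rewrite !conj_translationE.
have [s [e c _]] := colour_permuting_lift symS cphi ((phi^-1) y) tS.
have -> : (phi^-1) (y * t) = (phi^-1) y * s.
  by apply: (@perm_inj _ phi); rewrite permKV e permKV.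
by rewrite mulgA c.
Qed.

Lemma preserving_affineP S psi : colour_preserving S psi -> affine psi ->
  exists a : gT -> gT, [/\ {morph a : x y / x * y},
    forall x, psi x = psi 1 * a x & {in S, forall s, a s = s \/ a s = s^-1}].
Proof.
move=> cpsi [a /Aut_morphic/morphicP aM' [g psiE]].
have aM : {morph a : x y / x * y} by move=> x y; apply: aM'; rewrite inE.
have psi1 x : psi x = psi 1 * a x by rewrite !psiE mulg1 -aM.
exists a; split=> // s sS.
have := cpsi 1 s sS; rewrite mul1g psi1.
by case/set2P=> /mulgI; [left|right].
Qed.

(** Applying [a] twice fixes every generator, whether [a] fixes it or inverts
it. *)
Lemma preserving_morph_involutive S (a : gT -> gT) : cayley_connected S ->
  {morph a : x y / x * y} -> {in S, forall s, a s = s \/ a s = s^-1} ->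
  forall x, a (a x) = x.
Proof.
move=> conS aM aS.
have a1 : a 1 = 1 by apply: (mulgI (a 1)); rewrite -aM !mulg1.
have aV x : a x^-1 = (a x)^-1.
  by apply: (mulgI (a x)); rewrite -aM !mulgV.
apply: (@morph_eq_id S (fun x => a (a x))) => //.
  by move=> x y /=; rewrite !aM.
by move=> s sS; have [e|e] := aS s sS; rewrite !(aV, e) ?invgK.
Qed.

(** * Odd order *)

(** With [g = k ^+ 2] and [psi y = d * a y] the conjugate of translation by [k],
the conjugate of translation by [g] is [psi (psi y) = d * a d * a (a y)],
which is translation by [d * a d]. *)
Lemma cayley_CCA_strong_odd S : symmetric_set S -> cayley_connected S ->
  odd #|[set: gT]| -> cayley_CCA S -> cayley_strongly_CCA S.
Proof.
move=> symS conS oddG ccaS phi cphi; apply: affine_translations => g.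
pose k := g ^+ (#|[set: gT]|.+1)./2.
have gE : g = k * k.
  rewrite -expgD addnn even_halfK /= ?oddG //.
  by rewrite expgS expg_cardG ?inE // mulg1.
pose psi := conj_translation phi k.
have cpsi : colour_preserving S psi by apply: conj_translation_preserving.
have [a [aM psiE aS]] := preserving_affineP cpsi (ccaS _ cpsi).
have psi_phi x : psi (phi x) = phi (k * x) by rewrite conj_translationE permK.
exists (psi 1 * a (psi 1)) => x.
rewrite gE -mulgA -!psi_phi psiE (psiE (phi x)) aM.
by rewrite (preserving_morph_involutive conS aM aS) mulgA.
Qed.

(** * Abelian groups: squares and a non-affine automorphism *)

Section Abelian.

Hypothesis mulC : commutative (@mulg gT).

Lemma square_group_set : group_set [set x ^+ 2 | x in [set: gT]].
Proof.
apply/group_setP; split; first by apply/imsetP; exists 1; rewrite ?expg1n ?inE.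
move=> _ _ /imsetP[x _ ->] /imsetP[y _ ->].
apply/imsetP; exists (x * y); rewrite ?inE //.
by rewrite expgMn //; apply: mulC.
Qed.
Definition squares := Group square_group_set.

Lemma mem_squares x : x ^+ 2 \in squares.
Proof. by apply/imsetP; exists x; rewrite ?inE. Qed.

Lemma squaresP x : reflect (exists y, x = y ^+ 2) (x \in squares).
Proof.
apply: (iffP imsetP) => [[y _ ->]|[y ->]]; first by exists y.
by exists y; rewrite ?inE.
Qed.

Lemma mem_joing_cycle (N : {group gT}) g x :
  reflect (exists2 n, n \in N & exists k, x = n * g ^+ k) (x \in N <*> <[g]>).
Proof.
have cen : <[g]> \subset 'C(N).
  by apply/centsP=> a _ b _; apply: mulC.
rewrite (cent_joinEr cen).
apply: (iffP mulsgP) => [[n c Nn /cycleP[k ->] ->]|[n Nn [k ->]]].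
  by exists n => //; exists k.
by exists n (g ^+ k) => //; apply: mem_cycle.
Qed.

(** The quotient by [N] is an elementary abelian 2-group, that is, a vector
space over the field with two elements; this is the exchange property of linear
spans in it. *)
Lemma square_exchange (N : {group gT}) g h : squares \subset N ->
  h \in N <*> <[g]> -> h \notin N -> g \in N <*> <[h]>.
Proof.
move=> /subsetP QN /mem_joing_cycle[n Nn [k hE]] hN.
have sqN x : x ^+ 2 \in N by apply/QN/mem_squares.
have evN x m : x ^+ m.*2 \in N by rewrite -muln2 mulnC expgM groupX.
have [ok|ek] := boolP (odd k); last first.
  by case/negP: hN; rewrite hE -(even_halfK ek) groupM.
apply/mem_joing_cycle; pose m := n * g ^+ k./2.*2.
exists m^-1; first by rewrite groupV groupM.
exists 1%N; apply: (mulgI m); rewrite mulKVg expg1 hE /m -mulgA -expgSr.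
by rewrite odd_halfK // prednK // odd_gt0.
Qed.

(** Modulo squares, [r] and [u] are linearly independent, and [N] is a
complement of their span, obtained as a maximal subgroup avoiding
[r], [u] and [r * u]. *)
Lemma square_avoiding_group r u : r \notin squares -> u \notin squares ->
    r * u \notin squares ->
  exists N : {group gT}, [/\ squares \subset N,
    [/\ r \notin N, u \notin N & r * u \notin N]
    & forall x, x \in N <*> <[r]> <*> <[u]>].
Proof.
move=> rQ uQ ruQ.
pose P (N : {group gT}) :=
  [&& squares \subset N, r \notin N, u \notin N & r * u \notin N].
have PQ : P squares by apply/and4P; split.
have [N /maxgroupP[/and4P[QN rN uN ruN] maxN] _] := maxgroup_exists PQ.
exists N; split=> // g; apply/idPn=> gNru.
(* Adjoining [g] to [N] puts no new element in the span of [r] and [u] over [N]: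
   by exchange, such an element would bring [g] into this span. *)
have NsubM x : x \in N <*> <[g]> -> x \in N <*> <[r]> <*> <[u]> -> x \in N.
  move=> Ngx NruX; apply/idPn=> xN; case/negP: gNru.
  have := square_exchange QN Ngx xN; apply: subsetP.
  rewrite join_subG cycle_subG NruX andbT.
  by apply: subset_trans (joing_subl _ _); apply: joing_subl.
have memr : r \in N <*> <[r]> <*> <[u]>.
  apply: (subsetP (joing_subl _ _)); apply: (subsetP (joing_subr _ _)).
  exact: cycle_id.
have memu : u \in N <*> <[r]> <*> <[u]>.
  by apply: (subsetP (joing_subr _ _)); apply: cycle_id.
have PNg : P (N <*> <[g]>)%G.
  apply/and4P; split; first exact: subset_trans QN (joing_subl _ _).
  - by apply: contra rN => /NsubM->.
  - by apply: contra uN => /NsubM->.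
  - by apply: contra ruN => /NsubM-> //; rewrite groupM.
have /= eqN := maxN _ PNg (joing_subl _ _).
case/negP: gNru.
apply: (subsetP (joing_subl _ _)); apply: (subsetP (joing_subl _ _)).
by rewrite -eqN; apply: (subsetP (joing_subr _ _)); apply: cycle_id.
Qed.

(** Suppose neither [r] nor [r * u] is a square, put [z = r ^+ 2], and let [N]
be a complement of the span of [r] and [u] modulo squares.  Connect by the
elements of [N] and the square roots of [z], which include [r] and [r * u].  The
map that multiplies [N] by [z] and fixes everything else preserves colours: an
edge within a coset of [N] is translated, and an edge labelled by a root
[s] of [z] can only be changed by [z], where [s * z = s^-1].  It is not
affine, as it fixes [r], [u] and [r * u] but moves [1]. *)
Lemma CCA_order4_squares r u : group_CCA gT -> r ^+ 4 = 1 -> r ^+ 2 != 1 ->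
  u ^+ 2 = 1 -> u \notin squares -> r \in squares \/ r * u \in squares.
Proof.
move=> cca r4 r2 u2 uQ.
have [|rQ] := boolP (r \in squares); first by left.
have [|ruQ] := boolP (r * u \in squares); first by right.
have [N [QN [rN uN ruN] genN]] := square_avoiding_group rQ uQ ruQ.
have [z zE] : exists z, r ^+ 2 = z by exists (r ^+ 2).
rewrite zE in r2.
have zz : z * z = 1 by rewrite -zE -expgD.
have zV : z^-1 = z by apply: (mulgI z); rewrite mulgV zz.
have zN : z \in N by rewrite -zE (subsetP QN) ?mem_squares.
pose S := [set x | (x \in N) || (x ^+ 2 == z)].
have symS : symmetric_set S.
  apply/setP=> x; rewrite !inE groupV expVgn; congr (_ || _).
  by rewrite -{1}zV (inj_eq invg_inj).
have conS : cayley_connected S.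
  apply/cayley_connectedP/eqP; rewrite eqEsubset subsetT; apply/subsetP=> x _.
  have := genN x; apply: subsetP.
  have rS : r \in <<S>> by rewrite mem_gen // inE zE eqxx orbT.
  rewrite !join_subG !cycle_subG rS.
  have -> : u = r^-1 * (r * u) by rewrite mulKg.
  rewrite groupM ?groupV //; last first.
    by rewrite mem_gen // inE expgMn ?zE ?u2 ?mulg1 ?eqxx ?orbT //; apply: mulC.
  rewrite !andbT; apply/subsetP=> n Nn.
  by rewrite mem_gen // inE Nn.
pose f x := if x \in N then x * z else x.
have fK : involutive f.
  rewrite /f => x; have [xN|/negPf xN] := boolP (x \in N); last by rewrite xN.
  by rewrite groupM // -mulgA zz mulg1.
pose phi := perm (inv_inj fK).
have cphi : colour_preserving S phi.
  move=> x s; rewrite inE !permE /f => /orP[sN|/eqP s2].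
    rewrite groupMr //; case: ifP => _; last exact: set21.
    by rewrite -mulgA (mulC s) mulgA set21.
  have sV : s^-1 = s * z.
    by apply: (mulgI s); rewrite mulgV mulgA -[s * s]/(s ^+ 2) s2 zz.
  have xzs : x * z * s = x * s * z by rewrite -mulgA (mulC z s) mulgA.
  have xzsz : x * z * (s * z) = x * s by rewrite mulgA xzs -mulgA zz mulg1.
  rewrite sV; case: ifP => _; case: ifP => _;
    by rewrite ?xzs ?xzsz ?[x * (s * z)]mulgA (set21, set22).
have [a [aM phiE _]] := preserving_affineP cphi (cca S symS conS phi cphi).
have phi1 : phi 1 = z by rewrite permE /f group1 mul1g.
(* An affine map satisfies [phi (x * y) * phi 1 = phi x * phi y] in an abelian
   group. *)
have phiM x y : phi (x * y) * z = phi x * phi y.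
  rewrite (phiE (x * y)) (phiE x) (phiE y) aM phi1.
  by rewrite -!mulgA (mulC z (a y)).
have := phiM r u; rewrite !permE /f (negPf rN) (negPf uN) (negPf ruN).
by move/eqP; rewrite eq_sym eq_mulVg1 mulKg (negPf r2).
Qed.

(** * Abelian groups: the conjugates are translations *)

(** The [s]-edge from [x] to [s * x = x * s] is mapped to a [t]-edge, so
[t * a y] is [y * t] or [y * t^-1]; thus [a y] is [y] or [y * t ^- 2].  If the
second value is taken at [y] and [t ^+ 2] is nontrivial, then taking squares
gives [a (y ^+ 2) = y ^+ 2 * t ^- 4], whence [t ^+ 4 = 1]. *)
Lemma nontranslation_structure S phi t :
    symmetric_set S -> cayley_connected S -> cayley_CCA S ->
    colour_permuting S phi -> t \in S -> t \notin translations phi ->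
  [/\ t ^+ 4 = 1, t ^+ 2 != 1 & exists a : gT -> gT,
     [/\ {morph a : x y / x * y}, a t = t,
      forall y, a y = y \/ a y = y * t ^+ 2,
      {in S, forall s, a s = s \/ a s = s^-1}
      & exists s, forall x, phi (s * x) = t * a (phi x)]].
Proof.
move=> symS conS ccaS cphi tS tP.
(* Lifting at the preimage of [1] ensures that [psi 1] is [t], not [t^-1]. *)
have [s [e cs invo]] := colour_permuting_lift symS cphi ((phi^-1) 1) tS.
pose psi := conj_translation phi s.
have cpsi : colour_preserving S psi by apply: conj_translation_preserving.
have [a [aM psiE aS]] := preserving_affineP cpsi (ccaS _ cpsi).
have psi1 : psi 1 = t by rewrite conj_translationE mulC e permKV mul1g.
have phis x : phi (s * x) = t * a (phi x).
  by rewrite -psi1 -psiE conj_translationE permK.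
have a_alt y : a y = y \/ a y = y * t ^- 2.
  have := cs ((phi^-1) y); rewrite mulC phis permKV mulC.
  case/set2P=> [/mulIg|e']; first by left.
  by right; apply: (mulIg t); rewrite e' expgS expg1 invMg mulgA mulgKV.
have [y ay] : exists y, a y != y.
  apply/existsP; apply: contraT; rewrite negb_exists => /forallP aid.
  case/negP: tP; apply/translationsP.
  by exists s => x; rewrite phis; congr (_ * _); apply/eqP/negPn/aid.
have ayE : a y = y * t ^- 2 by have [e'|//] := a_alt y; rewrite e' eqxx in ay.
have t2 : t ^+ 2 != 1.
  by apply: contra ay => /eqP t2; rewrite ayE t2 invg1 mulg1.
have t4 : t ^+ 4 = 1.
  have ayy : a (y ^+ 2) = y ^+ 2 * t ^- 4.
    rewrite (aM y y : a (y ^+ 2) = a y ^+ 2) ayE.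
    by rewrite expgMn ?expgVn -?expgM //; apply: mulC.
  have [] := a_alt (y ^+ 2); rewrite ayy.
    rewrite -{2}[y ^+ 2]mulg1 => /mulgI e4.
    by rewrite -[t ^+ 4]invgK e4 invg1.
  move=> /mulgI/invg_inj e4; case/eqP: t2; apply: (mulgI (t ^+ 2)).
  by rewrite mulg1 -expgD.
have t2V : t ^- 2 = t ^+ 2.
  by apply: (mulgI (t ^+ 2)); rewrite mulgV -expgD t4.
split=> //; exists a; split=> //; first 1 last.
- by move=> x; rewrite -t2V.
- by exists s.
have [//|at_] := aS t tS.
(* If [a] inverted [t], the conjugate of translation by [s] would be an
   involution, and hence so would be [s] and [t]. *)
have ss : s * s = 1.
  apply: (mulIg 1); apply: (@perm_inj _ phi).
  rewrite -!mulgA !phis aM at_ mulKVg mul1g.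
  exact: (preserving_morph_involutive conS aM aS).
case/eqP: t2; rewrite expgS expg1.
by rewrite -{1}invo ?mulVg //; apply: (mulgI s); rewrite mulgV.
Qed.

Lemma gen_expg_mem S (P : {group gT}) n : cayley_connected S ->
  {in S, forall s, s ^+ n \in P} -> forall x, x ^+ n \in P.
Proof.
move=> conS SP x.
have gP : group_set [set y | y ^+ n \in P].
  apply/group_setP; split; first by rewrite inE expg1n group1.
  by move=> y z; rewrite !inE expgMn; [exact: groupM | exact: mulC].
have := gen_subset (H := Group gP) conS _ x.
by rewrite inE; apply; apply/subsetP=> s /SP; rewrite inE.
Qed.

(** A counterexample [t] yields an involution [u] moved by [a], hence not a
square; with it every generator is in [translations phi], or has order 4 and is
a square up to a factor [u].  This puts first all fourth powers and then all
squares in [translations phi], while [t] is a square because [a] fixes it. *)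
Lemma CCA_translations S phi : group_CCA gT -> symmetric_set S ->
  cayley_connected S -> colour_permuting S phi -> S \subset translations phi.
Proof.
move=> cca symS conS cphi; apply/subsetP=> t tS; apply/idPn=> tP.
have struct := nontranslation_structure symS conS (cca S symS conS) cphi.
have [t4 t2 [a [aM at_ a_alt aS [s phis]]]] := struct t tS tP.
have [s' s'S as'] : exists2 s', s' \in S & a s' != s'.
  apply/exists_inP; apply: contraT; rewrite negb_exists_in => /forall_inP aid.
  case/negP: tP; apply/translationsP; exists s => x; rewrite phis.
  by rewrite (morph_eq_id conS aM) // => r /aid/negPn/eqP.
have as'E : a s' = s' * t ^+ 2.
  by have [e|] := a_alt s'; rewrite ?e ?eqxx in as' *.
have s'2 : s' ^+ 2 = t ^+ 2.
  have [e|e] := aS s' s'S; first by rewrite e eqxx in as'.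
  apply: (mulIg (t ^+ 2)); rewrite -expgD t4.
  by rewrite expgS expg1 -mulgA -as'E e mulgV.
pose u := s' * t^-1.
have u2 : u ^+ 2 = 1.
  by rewrite expgMn ?s'2 ?expVgn ?mulgV //; apply: mulC.
have au x : a (x * u) = a x * u * t ^+ 2.
  have : a (x * s') = a (x * u) * t by rewrite -{1}at_ -aM /u -mulgA mulgKV.
  rewrite aM as'E => e; apply: (mulIg t); rewrite -e /u -!mulgA.
  by do 2!congr (_ * _); rewrite mulKg.
have aQ q : q \in squares -> a q = q.
  case/squaresP=> y ->; rewrite (aM y y : a (y ^+ 2) = a y ^+ 2).
  have [->//|->] := a_alt y.
  by rewrite expgMn -?expgM ?t4 ?mulg1 //; apply: mulC.
have a1 : a 1 = 1 by apply: (mulgI (a 1)); rewrite -aM !mulg1.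
have mulr_t2_neq x : x * t ^+ 2 != x by rewrite -{2}[x]mulg1 (inj_eq (mulgI x)).
have uQ : u \notin squares.
  apply/negP=> /aQ; rewrite -[u]mul1g au a1 !mul1g => /eqP.
  by rewrite (negPf (mulr_t2_neq u)).
have sq4 r : r ^+ 4 = 1 -> r ^+ 2 != 1 -> r \in squares \/ r * u \in squares.
  by move=> r4 r2; apply: CCA_order4_squares.
have P4 x : x ^+ 4 \in translations phi.
  apply: (gen_expg_mem conS) => r rS.
  have [/groupX->//|rP] := boolP (r \in translations phi).
  by have [-> _ _] := struct r rS rP; apply: group1.
have P2 x : x ^+ 2 \in translations phi.
  apply: (gen_expg_mem conS) => r rS.
  have [/groupX->//|rP] := boolP (r \in translations phi).
  have [r4 r2 _] := struct r rS rP.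
  have [/squaresP[q ->]|/squaresP[q e]] := sq4 r r4 r2.
    by rewrite -expgM P4.
  have <- : q ^+ 4 = r ^+ 2; last exact: P4.
  rewrite -[r ^+ 2]mulg1 -u2 -expgMn; last exact: mulC.
  by rewrite e -expgM.
have [/squaresP[q tE]|/aQ] := sq4 t t4 t2; first by rewrite tE P2 in tP.
by rewrite au at_ => /eqP; rewrite (negPf (mulr_t2_neq _)).
Qed.

Lemma CCA_strong_abelian : group_CCA gT -> group_strongly_CCA gT.
Proof.
move=> cca S symS conS phi cphi; apply: affine_translations => g.
have SP := CCA_translations cca symS conS cphi.
have /translationsP[g' g'E] := gen_subset conS SP (phi g * (phi 1)^-1).
(* At [x = 1] the equation reads [phi g' = phi g]. *)
have gg' : g' = g.
  by apply: (@perm_inj _ phi); rewrite -[g']mulg1 g'E mulgKV.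
by exists (phi g * (phi 1)^-1); rewrite -{1}gg'.
Qed.

End Abelian.
End ColourPermuting.

Theorem theorem1p5 (gT : finGroupType) :
  group_CCA gT ->
  abelian [set: gT] \/ odd #|[set: gT]| ->
  group_strongly_CCA gT.
Proof.
move=> cca [abG|oddG].
  apply: CCA_strong_abelian => // x y.
  by apply: (centsP abG); rewrite inE.
by move=> S symS conS; apply: cayley_CCA_strong_odd => //; apply: cca.
Qed.
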